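(* Let $\mathcal{T}\in\mathbb{R}^{I\times J\times I\times J}$ be symmetric and $R=\mathrm{rank}(f(\mathcal{T}))$, where $f$ is the matricization map. The tensor eigenvalue decomposition $\mathcal{T}=\mathcal{P}\ast_2\bar{\mathcal{D}}\ast_2\mathcal{P}^T$, written as the sum $$\mathcal{T}_{ij\hat i\hat j}=\sum_{k,l}\bar\sigma_{klkl}\,p_{ijkl}\,p_{\hat i\hat jkl},$$ where $\mathcal{P}\in\mathbb{R}^{I\times J\times I\times J}$ is an orthogonal tensor and $\bar{\mathcal{D}}\in\mathbb{R}^{I\times J\times I\times J}$ is a diagonal tensor with entries $\bar\sigma_{klkl}$ (the eigenvalues), is equivalent to the canonical polyadic (CP) decomposition $$\mathcal{T}=\sum_{r=1}^{R}a_r\circ b_r\circ c_r\circ d_r$$ if there exist $\mathcal{A}\in\mathbb{R}^{I\times I\times J}$ and $\mathcal{B}\in\mathbb{R}^{J\times I\times J}$ such that $a_{ikl}b_{jkl}=p_{ijkl}$.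
   Context: For $\mathcal{X},\mathcal{Y}\in\mathbb{R}^{I\times J\times I\times J}$: the Einstein product is $(\mathcal{X}\ast_2\mathcal{Y})_{ij\hat i\hat j}=\sum_{u=1}^{I}\sum_{v=1}^{J}x_{ijuv}y_{uv\hat i\hat j}$; the transpose is $(\mathcal{X}^T)_{ijkl}=x_{klij}$; $\mathcal{X}$ is symmetric if $\mathcal{X}=\mathcal{X}^T$; $\mathcal{X}$ is orthogonal if $\mathcal{X}^T\ast_2\mathcal{X}=\mathcal{I}$, where $\mathcal{I}$ has entries $(\mathcal{I})_{ijkl}=\delta_{ik}\delta_{jl}$; $\mathcal{X}$ is diagonal if $x_{ijkl}=0$ unless $i=k$ and $j=l$. Lower-case letters with indices denote the entries of the corresponding tensors. The matricization $f(\mathcal{X})\in\mathbb{R}^{IJ\times IJ}$ is $(f(\mathcal{X}))_{[i+(j-1)I],[k+(l-1)I]}=x_{ijkl}$. A CP decomposition of a fourth order tensor in $\mathbb{R}^{I\times J\times I\times J}$ is a linear combination of rank-one tensors, written $\sum_{r=1}^{R}a_r\circ b_r\circ c_r\circ d_r$ with $a_r,c_r\in\mathbb{R}^I$ and $b_r,d_r\in\mathbb{R}^J$, where $(a\circ b\circ c\circ d)_{ijkl}=a_ib_jc_kd_l$. *)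

(* Defs.v *)
From HB Require Import structures.
From mathcomp Require Import all_boot all_order all_algebra.
From mathcomp Require Import reals.

Set Implicit Arguments.
Unset Strict Implicit.
Unset Printing Implicit Defensive.

Import GRing.Theory.
Local Open Scope ring_scope.

(* Finite functions, so that tensor equality is Leibniz equality and the
   pointwise Z-module structure provides sums of tensors. *)
Notation tensor3 R m n p := {ffun 'I_m * 'I_n * 'I_p -> R}.
Notation tensor4 R m n := {ffun 'I_m * 'I_n * 'I_m * 'I_n -> R}.

Section Tensors.
Variables (R : realType) (m n : nat).
Implicit Types X Y P D T : tensor4 R m n.

Definition mktensor4 (F : 'I_m -> 'I_n -> 'I_m -> 'I_n -> R) : tensor4 R m n :=
  [ffun x => F x.1.1.1 x.1.1.2 x.1.2 x.2].

Lemma mktensor4E F i j k l : mktensor4 F (i, j, k, l) = F i j k l.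
Proof. by rewrite ffunE. Qed.

Definition einstein X Y : tensor4 R m n :=
  mktensor4 (fun i j k l =>
    \sum_(u < m) \sum_(v < n) X (i, j, u, v) * Y (u, v, k, l)).

Definition ttranspose X : tensor4 R m n :=
  mktensor4 (fun i j k l => X (k, l, i, j)).

Definition tid : tensor4 R m n :=
  mktensor4 (fun i j k l => (i == k)%:R * (j == l)%:R).

Definition tsymmetric X : Prop := X = ttranspose X.

Definition torthogonal X : Prop := einstein (ttranspose X) X = tid.

Definition tdiagonal X : Prop :=
  forall i j k l, ~ (i = k /\ j = l) -> X (i, j, k, l) = 0.

Definition outer4 (a : 'cV[R]_m) (b : 'cV[R]_n) (c : 'cV[R]_m) (d : 'cV[R]_n) :
    tensor4 R m n :=
  mktensor4 (fun i j k l => a i 0 * b j 0 * c k 0 * d l 0).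

(* With indices counted from 0, the position i + (j - 1) I becomes i + j * m,
   whose inverse sends p to (p %% m, p %/ m). *)
Fact mat_index_subproof (i : 'I_m) (j : 'I_n) : (i + j * m < m * n)%N.
Proof.
apply: (@leq_trans (j.+1 * m)); first by rewrite mulSn ltn_add2r.
by rewrite mulnC leq_mul2l ltn_ord orbT.
Qed.

Definition mat_index (i : 'I_m) (j : 'I_n) : 'I_(m * n) :=
  Ordinal (mat_index_subproof i j).

Fact mat_dim_gt0 (p : 'I_(m * n)) : (0 < m)%N.
Proof. by case: p => p; case: m => // m'; rewrite mul0n. Qed.

Fact mat_row_subproof (p : 'I_(m * n)) : (p %% m < m)%N.
Proof. by rewrite ltn_mod (mat_dim_gt0 p). Qed.

Fact mat_col_subproof (p : 'I_(m * n)) : (p %/ m < n)%N.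
Proof. by rewrite ltn_divLR ?(mat_dim_gt0 p) // [(n * m)%N]mulnC. Qed.

Definition matricize X : 'M[R]_(m * n) :=
  \matrix_(p, q)
    X (Ordinal (mat_row_subproof p), Ordinal (mat_col_subproof p),
       Ordinal (mat_row_subproof q), Ordinal (mat_col_subproof q)).

Lemma matricizeE X i j k l :
  matricize X (mat_index i j) (mat_index k l) = X (i, j, k, l).
Proof.
have rowE (a : 'I_m) (b : 'I_n) : Ordinal (mat_row_subproof (mat_index a b)) = a.
  by apply: val_inj; rewrite /= addnC modnMDl modn_small.
have colE (a : 'I_m) (b : 'I_n) : Ordinal (mat_col_subproof (mat_index a b)) = b.
  apply: val_inj; rewrite /= addnC divnMDl ?divn_small ?addn0 //.
  exact: leq_ltn_trans (ltn_ord a).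
by rewrite mxE !rowE !colE.
Qed.

Definition eigen_term P D (k : 'I_m) (l : 'I_n) : tensor4 R m n :=
  mktensor4 (fun i j i' j' =>
    D (k, l, k, l) * P (i, j, k, l) * P (i', j', k, l)).

Definition CP_decomposition T (rk : nat)
    (a : 'I_rk -> 'cV[R]_m) (b : 'I_rk -> 'cV[R]_n)
    (c : 'I_rk -> 'cV[R]_m) (d : 'I_rk -> 'cV[R]_n) : Prop :=
  T = \sum_(r < rk) outer4 (a r) (b r) (c r) (d r).

(* The rank-one terms are, up to the enumeration e, the eigen-terms with
   nonzero eigenvalue.  Terms are compared as tensors because the factor
   vectors of a rank-one tensor are only determined up to scaling. *)
Definition same_terms P D (rk : nat)
    (a : 'I_rk -> 'cV[R]_m) (b : 'I_rk -> 'cV[R]_n)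
    (c : 'I_rk -> 'cV[R]_m) (d : 'I_rk -> 'cV[R]_n) : Prop :=
  exists e : 'I_rk -> 'I_m * 'I_n,
    [/\ injective e,
        forall k l, D (k, l, k, l) != 0 <-> exists r, e r = (k, l)
      & forall r,
          outer4 (a r) (b r) (c r) (d r) = eigen_term P D (e r).1 (e r).2].

End Tensors.

(* Main.v *)
(* Matricization is multiplicative for the Einstein product, so an orthogonal
   tensor has an invertible matricization and rank (f T) is the number of
   nonzero eigenvalues.  Each eigen-term is a rank-one tensor because P factors
   as a_ikl b_jkl, so discarding the zero eigenvalues from the eigenvalue sum
   leaves exactly rank (f T) rank-one terms; conversely, adding back zero terms
   recovers the eigenvalue sum. *)
Require Import Defs.
From HB Require Import structures.
From mathcomp Require Import all_boot all_order all_algebra.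
From mathcomp Require Import reals.

Set Implicit Arguments.
Unset Strict Implicit.
Unset Printing Implicit Defensive.

Import GRing.Theory.
Local Open Scope ring_scope.

(** Induction on [n]: the first diagonal entry splits off as a 1 x 1 block, whose rank is 1 or 0
    according to whether the entry is nonzero. *)
Lemma rank_diag_mx (F : fieldType) (n : nat) (d : 'rV[F]_n) :
  \rank (diag_mx d) = (\sum_i (d 0%R i != 0%R))%N.
Proof.
elim: n d => [|n IHn] d; first by rewrite big_ord0 thinmx0 mxrank0.
rewrite -[d](@hsubmxK _ 1 1 n) (@diag_mx_row _ n 1)
  (@rank_diag_block_mx _ 1 1 n n) rank_rV IHn.
rewrite (@big_split_ord _ _ _ 1 n) big_ord1 /=; congr (_ + _)%N.
  rewrite (@row_mxEl _ 1 1 n) [diag_mx _]mx11_scalar mxE eqxx mulr1n.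
  by rewrite -scalemx1 scalemx_eq0 oner_eq0 orbF.
by apply: eq_bigr => i _; rewrite (@row_mxEr _ 1 1 n).
Qed.

Section Matricization.
Variables (R : realType) (m n : nat).
Implicit Types X Y P D : tensor4 R m n.

(** Inverse of [mat_index], packed as a pair so that sums over matrix positions can be reindexed as
    sums over pairs. *)
Definition mat_coord (p : 'I_(m * n)) : 'I_m * 'I_n :=
  (Ordinal (mat_row_subproof p), Ordinal (mat_col_subproof p)).

Lemma mat_coordK : cancel mat_coord (fun x => mat_index x.1 x.2).
Proof. by move=> p; apply: val_inj; rewrite /= addnC -divn_eq. Qed.

Lemma mat_indexK : cancel (fun x => mat_index x.1 x.2) mat_coord.
Proof.
move=> [i j]; congr (_, _); apply: val_inj => /=.
  by rewrite addnC modnMDl modn_small.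
rewrite addnC divnMDl ?divn_small ?addn0 //.
exact: leq_ltn_trans (ltn_ord i).
Qed.

(** The general codomain covers both uses: sums of tensor entries, and natural-number counts of
    nonzero eigenvalues. *)
Lemma sum_mat_coord (S : nmodType) (F : 'I_m * 'I_n -> S) :
  \sum_(p < m * n) F (mat_coord p) = \sum_x F x.
Proof.
rewrite [RHS](reindex mat_coord) //.
exists (fun x => mat_index x.1 x.2) => x _; first exact: mat_coordK.
exact: mat_indexK.
Qed.

Lemma matricizeM X Y :
  matricize (einstein X Y) = matricize X *m matricize Y.
Proof.
apply/matrixP => p q; rewrite !mxE mktensor4E pair_bigA /=.
rewrite -sum_mat_coord; by apply: eq_bigr => r _; rewrite !mxE.
Qed.

Lemma matricize_tr X : matricize (ttranspose X) = (matricize X)^T.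
Proof. by apply/matrixP => p q; rewrite !mxE mktensor4E. Qed.

Lemma matricize_id : matricize (tid R m n) = 1%:M.
Proof.
apply/matrixP => p q; rewrite !mxE mktensor4E -natrM mulnb.
(* Two positions agree exactly when both coordinates do, so the two Kronecker deltas merge into
   one. *)
by rewrite -(can_eq mat_coordK p q).
Qed.

Lemma matricize_diag D : tdiagonal D ->
  matricize D = diag_mx (\row_p
    D (mat_coord p, (mat_coord p).1, (mat_coord p).2)).
Proof.
move=> diagD; apply/matrixP => p q; rewrite !mxE.
have [->|npq] := eqVneq p q; first by [].
rewrite mulr0n diagD // => -[e1 e2]; case/eqP: npq.
by apply: (can_inj mat_coordK); congr (_, _).
Qed.

Lemma rank_matricize_diag D : tdiagonal D ->
  \rank (matricize D) = #|[pred x | D (x, x.1, x.2) != 0]|.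
Proof.
move=> /matricize_diag ->; rewrite rank_diag_mx -sum1_card [RHS]big_mkcond /=.
rewrite -[RHS]sum_mat_coord; apply: eq_bigr => p _; rewrite mxE inE.
by case: eqP.
Qed.

(** Orthogonality gives a left inverse, which suffices for a square matrix. *)
Lemma torthogonal_unitmx P : torthogonal P -> matricize P \in unitmx.
Proof.
move=> /(congr1 (@matricize R m n)); rewrite matricizeM matricize_id.
by case/mulmx1_unit.
Qed.

(** Multiplying by an invertible matrix on either side preserves the rank. *)
Lemma rank_matricize_conj P D : torthogonal P ->
  \rank (matricize (einstein (einstein P D) (ttranspose P)))
    = \rank (matricize D).
Proof.
move=> /torthogonal_unitmx uP; rewrite !matricizeM matricize_tr.
rewrite mxrankMfree ?row_free_unit ?unitmx_tr //.
by rewrite eqmxMfull // row_full_unit.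
Qed.

(** In the inner product of [P] and [D], only the summand with (u, v) = (k, l) survives. *)
Lemma einstein_conj_diag P D : tdiagonal D ->
  einstein (einstein P D) (ttranspose P) = \sum_x eigen_term P D x.1 x.2.
Proof.
move=> diagD; apply/ffunP => -[[[i j] i'] j'].
rewrite sum_ffunE mktensor4E pair_bigA /=; apply: eq_bigr => -[k l] _ /=.
rewrite !mktensor4E pair_bigA /= (bigD1 (k, l)) //= big1 ?addr0 => [|[u v]].
  by rewrite [_ * D _]mulrC.
rewrite xpair_eqE => /negP nuv; rewrite /= diagD ?mulr0 ?mul0r // => -[uk vl].
by case: nuv; rewrite uk vl !eqxx.
Qed.

Lemma eigen_term0 P D k l : D (k, l, k, l) = 0 -> eigen_term P D k l = 0.
Proof.
by move=> D0; apply/ffunP => -[[[i j] i'] j']; rewrite mktensor4E !ffunE D0 !mul0r.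
Qed.

(** The factorization separates i from j and i' from j'; the eigenvalue is absorbed into the first
    vector. *)
Lemma eigen_term_outer4 P D (A : tensor3 R m m n) (B : tensor3 R n m n) k l :
  (forall i j, A (i, k, l) * B (j, k, l) = P (i, j, k, l)) ->
  eigen_term P D k l =
    outer4 (\col_i (D (k, l, k, l) * A (i, k, l))) (\col_j B (j, k, l))
           (\col_i A (i, k, l)) (\col_j B (j, k, l)).
Proof.
move=> AB; apply/ffunP => -[[[i j] i'] j'].
by rewrite !mktensor4E !mxE -!AB !mulrA.
Qed.

(** By injectivity the left side is a sum over the image of [e]; every index outside it has
    eigenvalue zero, hence a zero term. *)
Lemma sum_eigen_term_support P D (rk : nat) (e : 'I_rk -> 'I_m * 'I_n) :
  injective e ->
  (forall k l, D (k, l, k, l) != 0 <-> exists r, e r = (k, l)) ->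
  \sum_r eigen_term P D (e r).1 (e r).2 = \sum_x eigen_term P D x.1 x.2.
Proof.
move=> inj_e supp_e.
rewrite -(big_imset (fun x => eigen_term P D x.1 x.2) (A := 'I_rk)) /=; last first.
  by move=> x y _ _; exact: inj_e.
apply: big_rmcond => -[k l] /imsetP nkl; apply: eigen_term0.
apply/eqP; apply: contraT => /supp_e [r er].
by case: nkl; exists r.
Qed.

End Matricization.

Theorem corollary3p20 (R : realType) (I J : nat) (T P D : tensor4 R I J)
    (rk : nat) (symT : tsymmetric T) (rkT : rk = \rank (matricize T))
    (orthP : torthogonal P) (diagD : tdiagonal D)
    (factorP : exists (A : tensor3 R I I J) (B : tensor3 R J I J),
       forall i j k l, A (i, k, l) * B (j, k, l) = P (i, j, k, l)) :
  (T = einstein (einstein P D) (ttranspose P) <->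
   forall i j i' j',
     T (i, j, i', j') =
     \sum_(k < I) \sum_(l < J)
        D (k, l, k, l) * P (i, j, k, l) * P (i', j', k, l)) /\
  (T = einstein (einstein P D) (ttranspose P) <->
   exists (a : 'I_rk -> 'cV[R]_I) (b : 'I_rk -> 'cV[R]_J)
          (c : 'I_rk -> 'cV[R]_I) (d : 'I_rk -> 'cV[R]_J),
     CP_decomposition T a b c d /\ same_terms P D a b c d).
Proof.
have eigE : einstein (einstein P D) (ttranspose P)
            = \sum_x eigen_term P D x.1 x.2 by exact: einstein_conj_diag.
split.
  rewrite eigE; split=> [-> i j i' j'|sumT].
    by rewrite sum_ffunE pair_bigA; apply: eq_bigr => -[k l] _; rewrite mktensor4E.
  apply/ffunP => -[[[i j] i'] j']; rewrite sumT sum_ffunE pair_bigA.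
  by apply: eq_bigr => -[k l] _; rewrite mktensor4E.
have [A [B AB]] := factorP.
split=> [defT | [a [b [c [d [-> [e [inj_e supp_e termE]]]]]]]]; last first.
  (* From CP to eigenvalues: [termE] identifies the rank-one terms with the eigen-terms along
     [e]. *)
  by rewrite eigE -(sum_eigen_term_support P inj_e supp_e); apply: eq_bigr.
pose S := [pred x | D (x, x.1, x.2) != 0].
(* The rank counts the nonzero eigenvalues, so ['I_rk] can enumerate their indices [S]; this
   enumeration is [e]. *)
have rkS : rk = #|S|.
  by rewrite rkT defT rank_matricize_conj // rank_matricize_diag.
pose e (r : 'I_rk) : 'I_I * 'I_J := enum_val (cast_ord rkS r).
have inj_e : injective e by move=> r s /enum_val_inj /cast_ord_inj.
have supp_e k l : D (k, l, k, l) != 0 <-> exists r, e r = (k, l).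
  split=> [Dkl | [r er]].
    have Skl : (k, l) \in S by [].
    exists (cast_ord (esym rkS) (enum_rank_in Skl (k, l))).
    by rewrite /e cast_ordKV enum_rankK_in.
  by have := enum_valP (cast_ord rkS r); rewrite -/(e r) er.
have termE r := eigen_term_outer4 D (fun i j => AB i j (e r).1 (e r).2).
(* Unification with [termE] supplies the vectors: the fibres of [A] and [B] at [e r], the first one
   scaled by the eigenvalue. *)
do 4 eexists; split; last by exists e; split=> // r; exact: esym (termE r).
rewrite /CP_decomposition {1}defT eigE -(sum_eigen_term_support P inj_e supp_e).
by apply: eq_bigr => r _; exact: termE.
Qed.
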